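(* Let $A\in\mathbb{R}^{n\times n}$ be symmetric with eigenvalues $\lambda_1\le\dots\le\lambda_n$, let $\mu\in\mathbb{R}$ not be an eigenvalue of $A$, and let $k=\#\{i:\lambda_i<\mu\}$, with $1\le k\le n-1$. Let $x\in\mathbb{R}^n$, let $m\ge 2$, and let $\mathtt{q}_m=\|x\|_2^2\,e_1^Th_\mu(T_m)e_1$ be the Lanczos approximation to $x^Th_\mu(A)x$ from the Krylov subspace $\mathcal{K}_m(A,x)$. Assume that there is no eigenvalue of $T_m$ in the interval $(\lambda_k,\lambda_{k+1})$. Then $$ |x^Th_\mu(A)x-\mathtt{q}_m|\ \le\ \frac{C_\theta\,\|x\|_2^2}{\sqrt{m-1}}\left(\frac{1-\theta}{1+\theta}\right)^{m-1}, $$ where $$ \theta=\frac{\min\{|\lambda_k-\mu|,\,|\lambda_{k+1}-\mu|\}}{\max\{|\lambda_1-\mu|,\,|\lambda_n-\mu|\}}\qquad\text{and}\qquad C_\theta=1+\frac{1-\theta}{\sqrt{\pi\theta}}. $$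
   Context: The step function $h_\mu:\mathbb{R}\to\mathbb{R}$ is $h_\mu(t)=1$ for $t<\mu$, $h_\mu(\mu)=1/2$, $h_\mu(t)=0$ for $t>\mu$; for a symmetric matrix $B$, $h_\mu(B)$ is the usual matrix function defined through the eigendecomposition of $B$. The quantity $\theta$ is called the relative spectral gap associated with $\mu$. $\mathcal{K}_m(A,x)=\mathrm{span}\{x,Ax,\dots,A^{m-1}x\}$ is the Krylov subspace of dimension $m$ associated with $A$ and $x$. The Lanczos algorithm builds $V_m\in\mathbb{R}^{n\times m}$, whose columns $v_1,\dots,v_m$ form an orthonormal basis of $\mathcal{K}_m(A,x)$ with $v_1=x/\|x\|_2$ and $v_1,\dots,v_j$ spanning $\mathcal{K}_j(A,x)$ for every $j\le m$; $T_m=V_m^TAV_m\in\mathbb{R}^{m\times m}$ is the resulting symmetric tridiagonal matrix. $e_1$ is the first canonical basis vector of $\mathbb{R}^m$. *)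

(* Defs.v *)
From mathcomp Require Import all_boot all_order all_algebra.
From mathcomp Require Import sesquilinear spectral complex.
From mathcomp Require Import boolp classical_sets reals trigo.
From mathcomp Require Import ring lra.

Set Implicit Arguments.
Unset Strict Implicit.
Unset Printing Implicit Defensive.

Import Order.TTheory GRing.Theory Num.Theory.
Local Open Scope ring_scope.

Definition step (R : realType) (mu t : R) : R :=
  if t < mu then 1 else if t == mu then 2^-1 else 0.

Definition eigendec (R : realType) (n : nat) (B : 'M[R]_n)
    (Q : 'M[R]_n) (d : 'rV[R]_n) : Prop :=
  Q^T *m Q = 1%:M /\ B = Q *m diag_mx d *m Q^T.

(* f(B) is computed from an eigendecomposition of B picked by choice: one
   exists for every symmetric B (eigendec_exists), and the value does not
   depend on which one is picked (mxfunE). *)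
Definition mxfun (R : realType) (f : R -> R) (n : nat) (B : 'M[R]_n) :
    'M[R]_n :=
  let p := xget (1%:M, 0)
             [set p : 'M[R]_n * 'rV[R]_n | eigendec B p.1 p.2]%classic in
  p.1 *m diag_mx (map_mx f p.2) *m p.1^T.

(* The library norm on matrices is the maximum norm, hence this definition. *)
Definition norm2 (R : realType) (n : nat) (x : 'cV[R]_n) : R :=
  Num.sqrt (\sum_i x i 0 ^+ 2).

Definition e1 (R : realType) (m : nat) : 'cV[R]_m :=
  \col_i (val i == 0%N)%:R.

Definition eigenvalues_of (R : realType) (n : nat) (A : 'M[R]_n)
    (lam : n.-tuple R) : Prop :=
  sorted <=%R lam /\ char_poly A = \prod_(a <- lam) ('X - a%:P).

Definition krylov (R : realType) (n : nat) (A : 'M[R]_n) (x : 'cV[R]_n)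
    (j : nat) : {vspace 'cV[R]_n} :=
  <<[seq A ^+ l *m x | l <- iota 0 j]>>%VS.

(* With j = m the last clause says that the m orthonormal columns of V span
   the Krylov space of order m, so that this space has dimension m. *)
Definition lanczos_basis (R : realType) (n m : nat) (A : 'M[R]_n)
    (x : 'cV[R]_n) (V : 'M[R]_(n, m)) : Prop :=
  [/\ V^T *m V = 1%:M,
      V *m e1 R m = (norm2 x)^-1 *: x &
      forall j : nat, (j <= m)%N ->
        <<[seq col i V | i : 'I_m <- enum 'I_m & (i < j)%N]>>%VS = krylov A x j].

Definition lanczos_mx (R : realType) (n m : nat) (A : 'M[R]_n)
    (V : 'M[R]_(n, m)) : 'M[R]_m :=
  V^T *m A *m V.

Definition lanczos_approx (R : realType) (n m : nat) (f : R -> R)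
    (A : 'M[R]_n) (x : 'cV[R]_n) (V : 'M[R]_(n, m)) : R :=
  norm2 x ^+ 2 *
    ((e1 R m)^T *m mxfun f (lanczos_mx A V) *m e1 R m) ord0 ord0.

(* The eigenvalues are numbered from 1 in the mathematics and from 0 in lam:
   lambda_k is lam`_k.-1 and lambda_(k+1) is lam`_k. *)
Definition rel_gap (R : realType) (n : nat) (lam : n.-tuple R) (mu : R)
    (k : nat) : R :=
  Num.min `|lam`_k.-1 - mu| `|lam`_k - mu| /
  Num.max `|lam`_0 - mu| `|lam`_n.-1 - mu|.

Definition Ctheta (R : realType) (theta : R) : R :=
  1 + (1 - theta) / Num.sqrt (pi * theta).

Lemma mxfunE (R : realType) (f : R -> R) (n : nat) (B Q : 'M[R]_n)
    (d : 'rV[R]_n) :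
  eigendec B Q d -> mxfun f B = Q *m diag_mx (map_mx f d) *m Q^T.
Proof.
move=> [QQ BE]; rewrite /mxfun.
have : eigendec B (xget (1%:M, 0)
    [set p : 'M[R]_n * 'rV[R]_n | eigendec B p.1 p.2]%classic).1
  (xget (1%:M, 0) [set p : 'M[R]_n * 'rV[R]_n | eigendec B p.1 p.2]%classic).2.
  by apply: (@xgetPex _ _ (fun p => eigendec B p.1 p.2)); exists (Q, d).
case: (xget _ _) => P c /= [PP BE'].
have QQ' := mulmx1C QQ; have PP' := mulmx1C PP.
pose W := Q^T *m P.
have WE : W *m diag_mx c = diag_mx d *m W.
  rewrite /W -mulmxA.
  have -> : P *m diag_mx c = B *m P by rewrite BE' -!mulmxA PP mulmx1.
  by rewrite BE !mulmxA QQ mul1mx.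
have WfE : W *m diag_mx (map_mx f c) = diag_mx (map_mx f d) *m W.
  move: (W) WE => Z /matrixP ZE; apply/matrixP => i j; move: (ZE i j).
  rewrite !mul_mx_diag !mul_diag_mx !mxE.
  have [->|Z0] := eqVneq (Z i j) 0; first by rewrite !(mul0r, mulr0).
  by rewrite mulrC => /(mulIf Z0) ->; rewrite mulrC.
have WW : W *m W^T = 1%:M.
  by rewrite /W trmx_mul trmxK -mulmxA (mulmxA P) PP' mul1mx.
have -> : P = Q *m W by rewrite /W mulmxA QQ' mul1mx.
clearbody W; by rewrite -(mulmxA Q) WfE trmx_mul !mulmxA -(mulmxA _ W) WW mulmx1.
Qed.

Lemma sym_eigenvalue (R : realType) (n : nat) (B : 'M[R]_n.+1) :
  B^T = B -> exists a, eigenvalue B a.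
Proof.
move=> BT; pose C := R[i]; pose Bc : 'M[C]_n.+1 := map_mx (real_complex R) B.
have Bh : Bc \is hermsymmx.
  apply/is_hermitianmxP; rewrite expr0 scale1r.
  apply/matrixP => i j; rewrite !mxE -{1}BT mxE /=.
  by rewrite /Num.conj /= oppr0.
have /hermitian_spectral_diag_real/mxOverP/(_ ord0 ord0) := Bh.
have /orthomx_spectralP BE := hermitian_normalmx Bh.
set d := spectral_diag _ in BE *; set U := spectralmx _ in BE.
move=> dR.
have Uu : U \in unitmx by exact: spectral_unit.
have ev : eigenvalue Bc (d ord0 ord0).
  apply/eigenvalueP; exists (row ord0 U).
    rewrite -row_mul BE !mulmxA mulmxV // mul1mx.
    by apply/rowP => j; rewrite mul_diag_mx !mxE.
  apply/eqP => r0; have : row ord0 (U *m invmx U) = 0 by rewrite row_mul r0 mul0mx.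
  by rewrite mulmxV // => /rowP/(_ ord0); rewrite !mxE eqxx => /eqP; rewrite oner_eq0.
have [a da] : exists a : R, d ord0 ord0 = (a%:C)%C.
  by move: dR; case: (d _ _) => a b; rewrite complex_real => /eqP /= ->; exists a.
exists a; move: ev; rewrite da !eigenvalue_root_char /Bc -map_char_poly.
by rewrite fmorph_root.
Qed.

Lemma row_sqr (R : realType) (n : nat) (w : 'rV[R]_n) :
  (w *m w^T) 0 0 = \sum_i w 0 i ^+ 2.
Proof. by rewrite mxE; apply: eq_bigr => i _; rewrite mxE. Qed.

Lemma row_sqr_eq0 (R : realType) (n : nat) (w : 'rV[R]_n) :
  (w *m w^T) 0 0 = 0 -> w = 0.
Proof.
rewrite row_sqr => /eqP; rewrite psumr_eq0 => [/allP w0|i _]; last exact: sqr_ge0.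
apply/rowP => i; have := w0 i (mem_index_enum _).
by rewrite sqrf_eq0 mxE => /eqP.
Qed.

Lemma householder (R : realType) (n : nat) (u : 'rV[R]_n.+1) :
  u *m u^T = 1%:M ->
  exists2 H : 'M[R]_n.+1, H *m H = 1%:M /\ H^T = H & delta_mx 0 0 *m H = u.
Proof.
move=> uu; pose e : 'rV[R]_n.+1 := delta_mx 0 0.
have ee : e *m e^T = 1%:M.
  rewrite /e trmx_delta mul_delta_mx; apply/matrixP => i j.
  by rewrite !ord1 !mxE.
have [->|ue] := eqVneq u e.
  by exists 1%:M; rewrite ?mulmx1 ?trmx1.
pose w := e - u; pose s : R := (w *m w^T) 0 0.
have sE : w *m w^T = s%:M by rewrite [LHS]mx11_scalar.
have s0 : s != 0.
  apply: contraNneq ue => sz; rewrite eq_sym -subr_eq0 -/w.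
  by rewrite [w]row_sqr_eq0.
pose t := (e *m u^T) 0 0.
have eu : e *m u^T = t%:M by rewrite [LHS]mx11_scalar.
have ue' : u *m e^T = t%:M by rewrite -[u in LHS]trmxK -trmx_mul eu tr_scalar_mx.
have st : s = 2 * (1 - t).
  have : s%:M = (2 * (1 - t))%:M :> 'M[R]_1.
    rewrite -sE /w linearB /= mulmxBl !mulmxBr ee uu eu ue' -!raddfB /=.
    by congr _%:M; ring.
  by move=> /matrixP/(_ 0 0); rewrite !mxE !mulr1n.
have ew : e *m w^T = (1 - t)%:M.
  by rewrite /w linearB /= mulmxBr ee eu -raddfB.
have wE : w = e - u by [].
clearbody w s t; exists (1%:M - (2 / s) *: (w^T *m w)); first split.
- rewrite mulmxBl mul1mx mulmxBr mulmx1 -scalemxAl -scalemxAr.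
  rewrite mulmxA -(mulmxA w^T) sE mul_mx_scalar -scalemxAl !scalerA.
  rewrite -{1}addrA; apply/eqP; rewrite -subr_eq0 addrAC subrr add0r.
  rewrite opprB addrC -addrA -!scaleNr -!scalerDl.
  by apply/eqP; rewrite (_ : _ + _ = 0) ?scale0r //; field.
- by rewrite linearB /= trmx1 linearZ /= trmx_mul trmxK.
- rewrite -/e mulmxBr mulmx1 -scalemxAr mulmxA ew mul_scalar_mx scalerA.
  have -> : 2 / s * (1 - t) = 1.
    by apply: (mulfI s0); rewrite mulr1 [in RHS]st; field.
  by rewrite scale1r wE opprB addrC subrK.
Qed.

Lemma eigendec_exists (R : realType) (n : nat) (B : 'M[R]_n) :
  B^T = B -> exists Q d, eigendec B Q d.
Proof.
elim: n B => [|n IHn] B BT.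
  by exists 1%:M, 0; split; apply/matrixP => -[].
have [a /eigenvalueP[v vB v0]] := sym_eigenvalue BT.
pose s : R := (v *m v^T) 0 0.
have sE : v *m v^T = s%:M by rewrite [LHS]mx11_scalar.
have s_gt0 : 0 < s.
  rewrite lt_def; apply/andP; split.
    by apply: contraNneq v0 => sz; rewrite [v]row_sqr_eq0.
  by rewrite /s row_sqr sumr_ge0 // => i _; exact: sqr_ge0.
pose u := (Num.sqrt s)^-1 *: v.
have uu : u *m u^T = 1%:M.
  rewrite /u linearZ /= -scalemxAl -scalemxAr sE scalerA scale_scalar_mx.
  by congr _%:M; rewrite -invfM -expr2 sqr_sqrtr ?ltW // mulVf ?gt_eqF.
have uB : u *m B = a *: u.
  by rewrite /u -scalemxAl vB !scalerA mulrC.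
have [H [HH HT] eH] := householder uu.
pose C : 'M[R]_(1 + n) := H *m B *m H.
have CT : C^T = C by rewrite /C !trmx_mul HT BT mulmxA.
have eC : delta_mx 0 0 *m C = a *: delta_mx 0 0 :> 'rV_(1 + n).
  by rewrite /C !mulmxA eH uB -scalemxAl -eH -mulmxA HH mulmx1.
have C0 j : C (lshift n 0) j = a * (j == lshift n 0)%:R.
  have -> : lshift n 0 = 0 :> 'I_(1 + n) by apply: val_inj.
  by move/rowP/(_ j): eC; rewrite -rowE !mxE.
have BE : B = H *m C *m H.
  by rewrite /C !mulmxA HH mul1mx -mulmxA HH mulmx1.
clearbody C.
pose B2 := drsubmx C.
have [|Q2 [d2 [Q2Q2 B2E]]] := IHn B2.
  by rewrite /B2 trmx_drsub CT.
have CE : C = block_mx a%:M 0 0 B2.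
  rewrite -[LHS]submxK; congr block_mx.
  - apply/matrixP => i j; rewrite !ord1 !mxE C0 eqxx mulr1.
    by rewrite ?mulr1n.
  - apply/matrixP => i j; rewrite !ord1 !mxE C0.
    by rewrite eq_rlshift mulr0.
  - apply/matrixP => i j; rewrite !ord1 !mxE -CT mxE C0.
    by rewrite eq_rlshift mulr0.
pose P : 'M[R]_(1 + n) := block_mx 1%:M 0 0 Q2.
have PP : P^T *m P = 1%:M.
  rewrite /P tr_block_mx !trmx0 trmx1 mulmx_block.
  rewrite !(mulmx0, mul0mx, mulmx1, addr0, add0r) Q2Q2.
  by rewrite -scalar_mx_block.
have PC : C = P *m diag_mx (row_mx a%:M d2) *m P^T.
  rewrite CE diag_mx_row /P tr_block_mx !trmx0 trmx1 !mulmx_block.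
  rewrite !(mulmx0, mul0mx, mulmx1, mul1mx, addr0, add0r) -B2E.
  by congr block_mx; apply/matrixP => i j; rewrite !ord1 !mxE.
clearbody P; exists (H *m P), (row_mx a%:M d2); split.
  by rewrite trmx_mul HT -mulmxA (mulmxA H) HH mul1mx.
by rewrite BE PC trmx_mul HT !mulmxA.
Qed.

(* Main.v *)
Require Import Defs.
From mathcomp Require Import all_boot all_order all_algebra reals trigo.
From mathcomp Require Import ring lra zify.
From mathcomp Require Import boolp classical_sets functions ereal topology.
From mathcomp Require Import normedtype derive realfun.
From mathcomp Require Import measure lebesgue_measure lebesgue_integral ftc.
Import Order.TTheory GRing.Theory Num.Theory numFieldNormedType.Exports.
Local Open Scope ring_scope.

Set Implicit Arguments.
Unset Strict Implicit.
Unset Printing Implicit Defensive.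

(**
Since h_mu(t) = (1 - sg (t - mu)) / 2, the proof combines a polynomial
approximation of the sign with the Gauss quadrature property of the Lanczos
method.

Linear algebra. For l < m the Krylov vector A^l x is |x| V T^l e_1
[lanczos_krylov], hence x^T p(A) x = |x|^2 e_1^T p(T) e_1 for every polynomial p
of degree at most 2 m - 1 [lanczos_approx_poly]. Replacing h_mu by p therefore
costs at most max |h_mu - p| |x|^2 on each side, the maximum being over the
eigenvalues of A and of T [lanczos_approx_dist]. The eigenvalues of T are
Rayleigh quotients of A, so they lie between lambda_1 and lambda_n
[ritz_value_bounds], and by hypothesis they avoid the gap around mu. Thus every
node t satisfies delta <= |t - mu| <= Delta with delta / Delta = theta.

Approximation. After scaling, one needs an odd polynomial x q(x^2) of degree
2 N + 1, with N = m - 1, close to the sign on a <= |x| <= 1, where a = theta;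
that is, q(y) close to 1 / sqrt y in a weighted sense on a^2 <= y <= 1. With
rho = (1 - a) / (1 + a) one has
  y = ((1 + a) / 2)^2 (1 + 2 rho X + rho^2)
where X is the affine image of y in [-1, 1]. In the formula
  1 / sqrt y = (1 / pi) int_0^oo ds / (sqrt s (y + s))
the substitution s = ((1 + a) / 2)^2 tan^2 phi (1 - rho^2 cos^2 phi) turns
1 / (y + s) into a multiple of the Poisson kernel
  (1 - u^2) / (1 + 2 u X + u^2) = 1 + 2 sum_(k >= 1) (- u)^k T_k(X)
with u = rho cos^2 phi; the integral itself is an arctangent [arc_primitive].
The polynomial q is obtained by truncating the kernel at degree N. What is left
of the kernel is explicit [cheb_geometric_sum]; weighted by
sqrt (1 + 2 rho X + rho^2) / sqrt (1 - rho^2 cos^2 phi), as in the integral, it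
is at most 2 rho^(N+1) cos^(2 N) phi / sqrt (1 - rho^2) [remainder_density_le]. The integral
of cos^(2 N) is bounded by Wallis [cosn_int_sqr_le], which gives the error
  (1 - a) / sqrt (pi a N) rho^N   [sign_approx].

The integrals over phi are handled as increments of antiderivatives between 0
and pi / 2, and compared through their derivatives [ler_dist_derive].
*)

(** * Derivatives and antiderivatives *)

Lemma is_derive_within_continuous (R : realType) (f df : R -> R) (a b : R) :
  (forall x, a <= x <= b -> is_derive x 1 f (df x)) ->
  {within `[a, b], continuous f}%classic.
Proof.
move=> fdf; apply: derivable_within_continuous => x; rewrite in_itv /= => ab.
exact: (@ex_derive _ _ _ _ _ _ _ (fdf x ab)).
Qed.

(** The inequality |int f'| <= int g', stated without integrals: g - f and g + f
    are nondecreasing. *)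
Lemma ler_dist_derive (R : realType) (f df g dg : R -> R) (a b : R) :
  a <= b ->
  (forall x, a <= x <= b -> is_derive x 1 f (df x)) ->
  (forall x, a <= x <= b -> is_derive x 1 g (dg x)) ->
  (forall x, a <= x <= b -> `|df x| <= dg x) ->
  `|f b - f a| <= g b - g a.
Proof.
move=> ab fdf gdg le_dfg.
have incr (s : R) : `|s| = 1 -> s * (f b - f a) <= g b - g a.
  move=> s1; pose h x := g x - s * f x.
  have hdh x : a <= x <= b -> is_derive x 1 h (dg x - s * df x).
    move=> xab; have fD := fdf x xab; have gD := gdg x xab.
    by apply: is_deriveB; apply: is_deriveZ.
  suff : h a <= h b by rewrite /h; lra.
  apply: (@ger0_derive1_ndecr _ h a b) => //.
  - move=> x; rewrite in_itv /= => /andP[ax xb].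
    by have D := hdh x (introT andP (conj (ltW ax) (ltW xb))); apply: ex_derive.
  - move=> x; rewrite in_itv /= => /andP[/ltW ax /ltW xb].
    have xab : a <= x <= b by rewrite ax.
    have D := hdh x xab.
    rewrite derive1E derive_val subr_ge0 (le_trans _ (le_dfg x xab)) //.
    by rewrite (le_trans (ler_norm _)) // normrM s1 mul1r.
  - exact: is_derive_within_continuous hdh.
rewrite ler_norml; apply/andP; split.
  by have := incr (-1); rewrite normrN1 => /(_ erefl); lra.
by have := incr 1; rewrite normr1 => /(_ erefl); lra.
Qed.

Lemma is_derive_derive1 (R : realType) (f : R -> R) (x d : R) :
  derivable f x 1 -> derive1 f x = d -> is_derive x 1 f d.
Proof. by move=> df fd; apply: DeriveDef => //; rewrite -derive1E. Qed.

(** The base point a - 1 and the upper limit b + 1 make the end points a and b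
    interior, so that the derivative there is two-sided. *)
Lemma continuous_antiderivative (R : realType) (f : R -> R) (a b : R) :
  continuous f ->
  exists F : R -> R, forall x, a <= x <= b -> is_derive x 1 F (f x).
Proof.
move=> cf.
exists (fun x => (\int[lebesgue_measure]_(t in `[(a - 1), x]%classic) f t)%R).
move=> x /andP[ax xb].
have xb1 : x < b + 1 by lra.
have intf : lebesgue_measure.-integrable `[(a - 1), (b + 1)]%classic (EFin \o f).
  apply: continuous_compact_integrable; first exact: segment_compact.
  exact: continuous_subspaceT.
have [|dF F'] := continuous_FTC1_closed xb1 intf _ (cf x); first by lra.
exact: is_derive_derive1 dF F'.
Qed.

(** * Wallis bound for the integrals of powers of the cosine *)

Fixpoint cosn_prim (R : realType) (n : nat) (x : R) : R :=
  match n with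
  | 0 => x
  | 1 => sin x
  | (n'.+1 as n1).+1 =>
      n1.+1%:R^-1 * (cos x ^+ n1 * sin x + n1%:R * cosn_prim n' x)
  end.

(** The reduction formula that integration by parts gives for cos^(n+2). *)
Lemma is_derive_cosn_prim (R : realType) (n : nat) (x : R) :
  is_derive x 1 (cosn_prim n) (cos x ^+ n).
Proof.
elim/ltn_ind: n => -[|[|n]] IHn.
- by rewrite expr0; apply: is_derive_id.
- by rewrite expr1; apply: is_derive_sin.
have D := IHn n (ltnW (ltnSn _)).
have DX : is_derive x 1 (cos ^+ n.+1 : R -> R) _ :=
  is_deriveX n.+1 (is_derive_cos x).
have DM : is_derive x 1 (cos ^+ n.+1 * sin : R -> R) _ :=
  is_deriveM DX (is_derive_sin x).
have DZ : is_derive x 1 (n.+1%:R *: cosn_prim n : R -> R) _ :=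
  is_deriveZ n.+1%:R D.
have -> : cosn_prim n.+2 = n.+2%:R^-1 \*:
    (cos ^+ n.+1 * sin + n.+1%:R *: cosn_prim n : R -> R).
  apply/funext => y; rewrite -[RHS]/(n.+2%:R^-1 *
    ((cos ^+ n.+1) y * sin y + n.+1%:R * cosn_prim n y)).
  by rewrite exprfctE.
apply: is_derive_eq (is_deriveZ (n.+2%:R)^-1 (is_deriveD DM DZ)) _.
rewrite !fctE /= /GRing.scale /=.
have cs : sin x * sin x = 1 - cos x * cos x.
  by rewrite -!expr2 -(cos2Dsin2 x) addrAC subrr add0r.
have n2 : (n.+2%:R : R) != 0 by rewrite pnatr_eq0.
apply: (mulfI n2); rewrite mulVKf // !exprS -[in RHS]natr1.
move: (sin x) (cos x) (cos x ^+ n) (n.+1%:R : R) cs => s c cn k cs.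
transitivity (c * cn * c - k * cn * (s * s) + k * cn); first by ring.
by rewrite cs; ring.
Qed.

(** The integral W_n of cos^n over [0, pi / 2]. *)
Definition cosn_int (R : realType) (n : nat) : R :=
  cosn_prim n (pi / 2) - cosn_prim n 0.

Lemma cosn_int_rec (R : realType) (n : nat) :
  n.+2%:R * cosn_int R n.+2 = n.+1%:R * cosn_int R n.
Proof.
rewrite /cosn_int /= cos_pihalf sin0 expr0n /= mul0r mulr0 !add0r -mulrBr.
by rewrite mulVKf ?pnatr_eq0 // -mulrBr.
Qed.

(** The recurrence makes (n + 1) W_(n+1) W_n independent of n. *)
Lemma cosn_int_mul (R : realType) (n : nat) :
  n.+1%:R * (cosn_int R n.+1 * cosn_int R n) = pi / 2.
Proof.
elim: n => [|n IHn].
  by rewrite /cosn_int /= sin_pihalf sin0; ring.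
by rewrite mulrA cosn_int_rec -IHn; ring.
Qed.

Lemma cosn_int_bound (R : realType) (n : nat) :
  0 <= cosn_int R n.+1 <= cosn_int R n.
Proof.
have pi2 : 0 <= pi / 2 :> R by have := pi_gt0 R; lra.
have cos01 (x : R) : 0 <= x <= pi / 2 -> 0 <= cos x <= 1.
  by move=> xb; rewrite cos_le1 andbT cos_ge0_pihalf //; lra.
apply/andP; split.
  apply: (le_trans (normr_ge0 (0 - 0 : R))).
  apply: (@ler_dist_derive _ (fun=> 0) (fun=> 0) _ (fun x => cos x ^+ n.+1)) => //.
    by move=> x _; apply: is_derive_cosn_prim.
  by move=> x /cos01/andP[c0 c1]; rewrite normr0 exprn_ge0.
apply: le_trans (ler_norm _) _.
apply: (@ler_dist_derive _ _ (fun x => cos x ^+ n.+1) _ (fun x => cos x ^+ n)) => //.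
- by move=> x _; apply: is_derive_cosn_prim.
- by move=> x _; apply: is_derive_cosn_prim.
move=> x /cos01/andP[c0 c1]; rewrite ger0_norm ?exprn_ge0 //.
by rewrite exprS ler_piMl // exprn_ge0.
Qed.

(** W_(n+1)^2 <= W_(n+1) W_n, and this product is known exactly. *)
Lemma cosn_int_sqr_le (R : realType) (n : nat) :
  (cosn_int R n.+1) ^+ 2 <= pi / (2 * n.+1%:R).
Proof.
have /andP[W0 W1] := cosn_int_bound R n.
have n1 : 0 < n.+1%:R :> R by rewrite ltr0n.
rewrite -(ler_pM2l n1).
have -> : n.+1%:R * (pi / (2 * n.+1%:R)) = pi / 2 :> R.
  by field; rewrite gt_eqF //= gt_eqF.
rewrite -(cosn_int_mul R n) ler_pM2l // expr2.
exact: ler_wpM2l.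
Qed.

(** * Chebyshev polynomials of the first kind *)

Fixpoint cheb (R : comNzRingType) (n : nat) : {poly R} :=
  match n with
  | 0 => 1
  | 1 => 'X
  | (n'.+1 as n1).+1 => 2%:P * 'X * cheb R n1 - cheb R n'
  end.

Lemma size_cheb (R : comNzRingType) (n : nat) : (size (cheb R n) <= n.+1)%N.
Proof.
elim/ltn_ind: n => -[|[|n]] IHn; first by rewrite size_poly1.
  by rewrite size_polyX.
rewrite -[cheb R n.+2]/(2%:P * 'X * cheb R n.+1 - cheb R n).
have sn1 := IHn n.+1 (ltnSn _); have sn : (size (cheb R n) <= n.+3)%N.
  by rewrite (leq_trans (IHn n _)) ?ltnS // -addn2 leq_addr.
rewrite (leq_trans (size_polyD _ _)) // geq_max size_polyN sn andbT.
rewrite mul_polyC -scalerAl (leq_trans (size_scale_leq _ _)) //.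
by rewrite (leq_trans (size_polyMleq _ _)) // size_polyX ltnS.
Qed.

Lemma horner_chebSS (R : comNzRingType) (n : nat) (X : R) :
  (cheb R n.+2).[X] = 2 * X * (cheb R n.+1).[X] - (cheb R n).[X].
Proof. by rewrite /= !hornerE. Qed.

Lemma cheb_cos (R : realType) (n : nat) (a : R) :
  (cheb R n).[cos a] = cos (n%:R * a).
Proof.
elim/ltn_ind: n => -[|[|n]] IHn.
- by rewrite /= hornerE mul0r cos0.
- by rewrite /= hornerE mul1r.
rewrite horner_chebSS !IHn ?ltnS //.
have -> : n.+2%:R * a = n.+1%:R * a + a by rewrite -natr1; ring.
have -> : n%:R * a = n.+1%:R * a - a by rewrite -natr1; ring.
by rewrite cosB cosD; ring.
Qed.

(** With X = cos a, a real part is compared with a modulus: the sum being squared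
    is the real part of exp (i n a) (exp (i a) + u), and the right-hand side is
    the squared modulus of that number. *)
Lemma cheb_comb_le (R : realType) (n : nat) (X u : R) : -1 <= X <= 1 ->
  ((cheb R n.+1).[X] + u * (cheb R n).[X]) ^+ 2 <= 1 + 2 * u * X + u ^+ 2.
Proof.
move=> X1; rewrite -(acosK (X1 : X \in `[-1, 1]%R)) !cheb_cos.
set a := acos X; have -> : n.+1%:R * a = n%:R * a + a by rewrite -natr1; ring.
rewrite cosD; have := cos2Dsin2 a; have := cos2Dsin2 (n%:R * a).
move: (cos a) (sin a) (cos _) (sin _) => c s cn sn csn cs.
suff -> : 1 + 2 * u * c + u ^+ 2 =
  (cn * c - sn * s + u * cn) ^+ 2 + (cn * s + sn * (c + u)) ^+ 2.
  by rewrite lerDl sqr_ge0.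
transitivity (((c + u) ^+ 2 + s ^+ 2) * (cn ^+ 2 + sn ^+ 2)); last by ring.
rewrite csn mulr1.
transitivity ((c ^+ 2 + s ^+ 2) + 2 * u * c + u ^+ 2); last by ring.
by rewrite cs.
Qed.

(** Truncated expansion of the Poisson kernel. The factor 2 - (k == 0) is the
    usual halving of the constant Chebyshev term. *)
Lemma cheb_geometric_sum (R : comNzRingType) (n : nat) (X u : R) :
  (1 + 2 * u * X + u ^+ 2) *
    (\sum_(k < n.+1) (2 - (k == 0%N :> nat)%:R) * (- u) ^+ k * (cheb R k).[X])
  = 1 - u ^+ 2 - 2 * (- u) ^+ n.+1 * ((cheb R n.+1).[X] + u * (cheb R n).[X]).
Proof.
elim: n => [|n IHn].
  by rewrite big_ord_recl big_ord0 /= hornerC hornerX; ring.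
rewrite big_ord_recr mulrDr IHn horner_chebSS /= subr0 (exprS _ n.+1).
by ring.
Qed.

(** * The arctangent integral for 1 / sqrt y *)

Lemma is_derive_bigsum (R : realType) (n : nat) (f : nat -> R -> R)
    (c df : nat -> R) (x : R) :
  (forall k, is_derive x 1 (f k) (df k)) ->
  is_derive x 1 (fun y => \sum_(k < n) c k * f k y) (\sum_(k < n) c k * df k).
Proof.
move=> fD; elim: n => [|n IHn].
  rewrite big_ord0; have -> : (fun y => \sum_(k < 0) c k * f k y) = cst 0.
    by apply/funext => y; rewrite big_ord0.
  exact: is_derive_cst.
rewrite big_ord_recr /=.
have -> : (fun y => \sum_(k < n.+1) c k * f k y) =
    (fun y => \sum_(k < n) c k * f k y) + (c n \*: f n).
  by apply/funext => y; rewrite big_ord_recr.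
by apply: is_deriveD; apply: is_deriveZ.
Qed.

(** This function is the polar angle of the point (E, N). The half-angle form
    2 atan (N / (D + E)), where D is the norm of the point, stays smooth, unlike
    atan (N / E), where E vanishes, which happens at the end point pi / 2 in
    [arc_primitive]. *)
Lemma is_derive_half_angle (R : realType) (N E : R -> R) (x dN dE : R) :
  is_derive x 1 N dN -> is_derive x 1 E dE ->
  0 < N x ^+ 2 + E x ^+ 2 -> 0 <= E x ->
  is_derive x 1
    (fun y => 2 * atan (N y / (Num.sqrt (N y ^+ 2 + E y ^+ 2) + E y)))
    ((dN * E x - N x * dE) / (N x ^+ 2 + E x ^+ 2)).
Proof.
move=> ND ED D2_gt0 E0.
pose D2 y := N y ^+ 2 + E y ^+ 2.
have D2D : is_derive x 1 D2 _ := is_deriveD (is_deriveX 2 ND) (is_deriveX 2 ED).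
have sD := is_derive1_sqrt D2_gt0.
have DD := @is_derive1_comp _ Num.sqrt D2 x _ _ sD D2D.
have den0 : (Num.sqrt \o D2) x + E x != 0.
  by rewrite gt_eqF // ltr_pwDl // sqrtr_gt0.
have VD := @is_deriveV _ ((Num.sqrt \o D2) + E) x _ 1 den0 (is_deriveD DD ED).
have QD := is_deriveM ND VD.
have TD := is_deriveZ 2 (@is_derive1_comp _ atan _ x _ _ (is_derive1_atan _) QD).
apply: is_derive_eq TD _.
set d := Num.sqrt (N x ^+ 2 + E x ^+ 2); set n := N x; set e := E x.
rewrite -[LHS]/(2 * ((1 + (n * (d + e)^-1) ^+ 2)^-1 *
  (n * (- ((d + e) ^+ 2)^-1 * ((2 * d)^-1 * (2 * n * dN + 2 * e * dE) + dE))
   + (d + e)^-1 * dN))).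
have d0 : d != 0 by rewrite gt_eqF // sqrtr_gt0.
have dE2 : n ^+ 2 + e ^+ 2 = d ^+ 2 by rewrite sqr_sqrtr // ltW.
have n2 : n ^+ 2 = (d - e) * (d + e) by rewrite -subr_sqr -dE2 addrK.
have de0 : d + e != 0 := den0.
rewrite dE2; clear dE2; move: (d) (n) (e) d0 n2 de0 => {}d {}n {}e d0 n2 de0.
have -> : 1 + (n * (d + e)^-1) ^+ 2 = 2 * d / (d + e).
  by rewrite exprMn n2; field.
have -> : n * (- ((d + e) ^+ 2)^-1 * ((2 * d)^-1 * (2 * n * dN + 2 * e * dE) + dE))
   + (d + e)^-1 * dN
   = (dN * (d * (d + e) - n ^+ 2) - n * (d + e) * dE) / (d * (d + e) ^+ 2).
  by field; rewrite ?d0 ?de0.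
by rewrite n2; field; rewrite ?d0 ?de0.
Qed.

Lemma cos_sqr_le1 (R : realType) (x : R) : cos x ^+ 2 <= 1.
Proof. by rewrite -(cos2Dsin2 x) lerDl sqr_ge0. Qed.

Lemma weight_gt0 (R : realType) (rho x : R) : 0 <= rho < 1 ->
  0 < 1 - rho ^+ 2 * cos x ^+ 2.
Proof.
move=> /andP[r0 r1]; rewrite subr_gt0 (@le_lt_trans _ _ (rho ^+ 2)) ?expr_lt1 //.
by rewrite ler_piMr ?sqr_ge0 // cos_sqr_le1.
Qed.

(** Ordinate of the point whose polar angle is the primitive of
    [arc_primitive]. *)
Lemma is_derive_sin_sqrt (R : realType) (rho x : R) : 0 <= rho < 1 ->
  let r y := Num.sqrt (1 - rho ^+ 2 * cos y ^+ 2) in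
  is_derive x 1 (fun y => sin y * r y)
    (cos x * r x + sin x * (rho ^+ 2 * cos x * sin x / r x)).
Proof.
move=> rho01 r; pose s2 y := 1 - rho ^+ 2 * cos y ^+ 2.
have s2_gt0 : 0 < s2 x by exact: weight_gt0.
have DC : is_derive x 1 (fun y => cos y ^+ 2) _ := is_deriveX 2 (is_derive_cos x).
have D1 : is_derive x 1 (fun=> 1 : R) 0 := is_derive_cst (1 : R) x (1 : R).
have DS : is_derive x 1 s2 _ := is_deriveB D1 (is_deriveZ (rho ^+ 2) DC).
have sD := is_derive1_sqrt s2_gt0.
have RD := @is_derive1_comp _ Num.sqrt s2 x _ _ sD DS.
apply: is_derive_eq (is_deriveM (is_derive_sin x) RD) _.
rewrite /GRing.scale /= /GRing.scale /= -/(r x) -/(s2 x).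
have rx0 : r x != 0 by rewrite gt_eqF // sqrtr_gt0.
by field.
Qed.

Lemma continuous_weight (R : realType) (rho : R) (k : nat) : 0 <= rho < 1 ->
  continuous (fun y : R =>
    (cos y ^+ 2) ^+ k / Num.sqrt (1 - rho ^+ 2 * cos y ^+ 2)).
Proof.
move=> rho01 x.
have cC (j : nat) :
    ((cos y ^+ 2) ^+ j @[y --> x] --> (cos x ^+ 2) ^+ j)%classic.
  have -> : (fun y : R => (cos y ^+ 2) ^+ j) = (fun z : R => z ^+ (2 * j)) \o cos.
    by apply/funext => y; rewrite /= exprM.
  rewrite -exprM.
  exact: (@continuous_comp _ _ _ cos (fun z : R => z ^+ (2 * j)) x
    (@continuous_cos R x) (@exprn_continuous R (2 * j) (cos x))).
apply: cvgM; first exact: cC.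
apply: cvgV; first by rewrite gt_eqF // sqrtr_gt0; exact: weight_gt0.
apply: (@continuous_comp _ _ _ (fun y : R => 1 - rho ^+ 2 * cos y ^+ 2)
  Num.sqrt x); last exact: sqrt_continuous.
by apply: cvgB; [exact: cvg_cst | apply: cvgMr; exact: (cC 1%N)].
Qed.

(** The point (sqrt Y cos y, sin y r(y)) has squared norm 1 + 2 u X + u^2 and
    moves from the positive horizontal axis to the positive vertical axis, so
    its polar angle Phi grows by pi / 2. Its angular speed is sqrt Y / r times
    the Poisson kernel: this is the integral formula for 1 / sqrt Y. *)
Lemma arc_primitive (R : realType) (rho X : R) : 0 <= rho < 1 -> -1 <= X <= 1 ->
  let Y := 1 + 2 * rho * X + rho ^+ 2 in
  let r y := Num.sqrt (1 - rho ^+ 2 * cos y ^+ 2) in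
  exists Phi : R -> R,
    Phi (pi / 2) - Phi 0 = pi / 2 /\
    forall x, 0 <= x <= pi / 2 ->
      let u := rho * cos x ^+ 2 in
      is_derive x 1 Phi
        (Num.sqrt Y * (1 - u ^+ 2) / ((1 + 2 * u * X + u ^+ 2) * r x)).
Proof.
move=> rho01 /andP[X0 X1] Y r; have /andP[rho0 rho1] := rho01.
pose N y := sin y * r y; pose E y := Num.sqrt Y * cos y.
have Y0 : 0 <= Y.
  have -> : Y = (1 - rho) ^+ 2 + 2 * rho * (1 + X) by rewrite /Y; ring.
  by rewrite addr_ge0 ?sqr_ge0 // !mulr_ge0 //; lra.
have NE x : N x ^+ 2 + E x ^+ 2 =
    1 + 2 * (rho * cos x ^+ 2) * X + (rho * cos x ^+ 2) ^+ 2.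
  rewrite /N /E !exprMn sqr_sqrtr ?(ltW (weight_gt0 _ _)) // sqr_sqrtr //.
  have -> : sin x ^+ 2 = 1 - cos x ^+ 2 by rewrite -(cos2Dsin2 x) addrC addKr.
  by rewrite /Y; ring.
exists (fun y => 2 * atan (N y / (Num.sqrt (N y ^+ 2 + E y ^+ 2) + E y))); split.
  have r1 : r (pi / 2) = 1 by rewrite /r cos_pihalf expr0n mulr0 subr0 sqrtr1.
  rewrite /N /E sin0 !mul0r atan0 cos_pihalf sin_pihalf r1 !mulr0 mulr1.
  by rewrite expr0n /= expr1n !addr0 sqrtr1 divr1 atan1; field.
move=> x xb u.
have D0 : 0 < N x ^+ 2 + E x ^+ 2.
  rewrite NE -/u.
  have u0 : 0 <= u by rewrite mulr_ge0 ?sqr_ge0.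
  have u1 : u < 1.
    by rewrite (le_lt_trans _ rho1) // ler_piMr // cos_sqr_le1.
  have -> : 1 + 2 * u * X + u ^+ 2 = (1 - u) ^+ 2 + 2 * u * (1 + X) by ring.
  rewrite ltr_wpDr ?exprn_gt0 ?subr_gt0 // mulr_ge0 ?(mulr_ge0 _ u0) //; lra.
have E0 : 0 <= E x by rewrite mulr_ge0 ?sqrtr_ge0 // cos_ge0_pihalf //; lra.
have ND : is_derive x 1 N _ := is_derive_sin_sqrt x rho01.
have ED : is_derive x 1 E _ := is_deriveZ (Num.sqrt Y) (is_derive_cos x).
have rx0 : r x != 0 by rewrite gt_eqF // sqrtr_gt0; exact: weight_gt0.
have r2 : r x ^+ 2 = 1 - rho ^+ 2 * cos x ^+ 2.
  by rewrite sqr_sqrtr // ltW //; exact: weight_gt0.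
apply: is_derive_eq (is_derive_half_angle ND ED D0 E0) _.
have NEu : 1 + 2 * u * X + u ^+ 2 = N x ^+ 2 + E x ^+ 2 by rewrite NE.
rewrite NEu; move: (N x ^+ 2 + E x ^+ 2) D0 => D D0.
rewrite invfM (mulrC D^-1) [RHS]mulrA; congr (_ / D).
rewrite -[LHS]/((cos x * r x + sin x * (rho ^+ 2 * cos x * sin x / r x)) *
  (Num.sqrt Y * cos x) - sin x * r x * (Num.sqrt Y * - sin x)).
have s2 : sin x ^+ 2 = 1 - cos x ^+ 2 by rewrite -(cos2Dsin2 x) addrC addKr.
apply: (mulIf rx0); rewrite divfK // /u.
move: (r x) (sin x) (cos x) (Num.sqrt Y) rx0 r2 s2 => v s c y v0 v2 s2.
transitivity (y * (v ^+ 2 * (c ^+ 2 + s ^+ 2) + rho ^+ 2 * c ^+ 2 * s ^+ 2)).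
  by field.
by rewrite v2 s2; ring.
Qed.

(** * Polynomial approximation of the sign and of the step *)

(** The factor t sqrt (1 + 2 rho X + rho^2) is at most sqrt P, which absorbs one
    power of t and one square root of P; the bound on v absorbs the other. *)
Lemma remainder_density_le (R : realType) (rho X t v : R) (n : nat) :
  0 <= rho < 1 -> -1 <= X <= 1 -> 0 <= t <= 1 ->
  let u := rho * t in
  let P := 1 + 2 * u * X + u ^+ 2 in
  v ^+ 2 <= P ->
  `|Num.sqrt (1 + 2 * rho * X + rho ^+ 2) * (2 * (- u) ^+ n.+1 * v) /
     (P * Num.sqrt (1 - rho ^+ 2 * t))|
  <= 2 * rho ^+ n.+1 / Num.sqrt (1 - rho ^+ 2) * t ^+ n.
Proof.
move=> /andP[rho0 rho1] /andP[X0 X1] /andP[t0 t1] u P vP.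
have u0 : 0 <= u by rewrite mulr_ge0.
have u1 : u < 1 by rewrite (le_lt_trans _ rho1) // ler_piMr.
have P0 : 0 < P.
  have -> : P = (1 - u) ^+ 2 + 2 * u * (1 + X) by rewrite /P; ring.
  by rewrite ltr_wpDr ?exprn_gt0 ?subr_gt0 // mulr_ge0 ?(mulr_ge0 _ u0) //; lra.
have Y0 : 0 <= 1 + 2 * rho * X + rho ^+ 2.
  have -> : 1 + 2 * rho * X + rho ^+ 2 = (1 - rho) ^+ 2 + 2 * rho * (1 + X) by ring.
  by rewrite addr_ge0 ?sqr_ge0 // mulr_ge0 ?(mulr_ge0 _ rho0) //; lra.
have r2 : 0 < 1 - rho ^+ 2 by rewrite subr_gt0 expr_lt1.
have r_le : Num.sqrt (1 - rho ^+ 2) <= Num.sqrt (1 - rho ^+ 2 * t).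
  by rewrite ler_wsqrtr // lerB // ler_piMr ?sqr_ge0.
have v_le : `|v| <= Num.sqrt P by rewrite -sqrtr_sqr ler_wsqrtr.
have Yt_le : t * Num.sqrt (1 + 2 * rho * X + rho ^+ 2) <= Num.sqrt P.
  rewrite -{1}(ger0_norm t0) -sqrtr_sqr -sqrtrM ?sqr_ge0 // ler_wsqrtr //.
  rewrite -subr_ge0.
  have -> : P - t ^+ 2 * (1 + 2 * rho * X + rho ^+ 2)
    = (1 - t) * (1 - t + 2 * t * (1 + rho * X)) by rewrite /P /u; ring.
  have rX : 0 <= 1 + rho * X by nra.
  apply: mulr_ge0; first by rewrite subr_ge0.
  by rewrite addr_ge0 ?subr_ge0 // !mulr_ge0.
move: (Num.sqrt (1 + 2 * rho * X + rho ^+ 2))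
  (sqrtr_ge0 (1 + 2 * rho * X + rho ^+ 2)) Yt_le => y y0 yt.
have sP0 : 0 < Num.sqrt P by rewrite sqrtr_gt0.
have s0 : 0 < Num.sqrt (1 - rho ^+ 2) by rewrite sqrtr_gt0.
have s1 := lt_le_trans s0 r_le.
rewrite normrM normfV (gtr0_norm (mulr_gt0 P0 s1)) ler_pdivrMr ?mulr_gt0 //.
rewrite !normrM (ger0_norm y0) normrX normrN (ger0_norm u0) (ger0_norm (ler0n _ 2)).
rewrite -[in leRHS](sqr_sqrtr (ltW P0)) /u exprMn (exprSr t).
move: (Num.sqrt P) sP0 yt v_le => p p0 yt vp.
have -> : y * (2 * (rho ^+ n.+1 * (t ^+ n * t)) * `|v|)
   = 2 * rho ^+ n.+1 * t ^+ n * ((t * y) * `|v|) by ring.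
move: (Num.sqrt (1 - rho ^+ 2 * t)) s1 r_le => s' s'0 ss'.
move: (Num.sqrt (1 - rho ^+ 2)) s0 ss' => s s0 ss'.
have -> : 2 * rho ^+ n.+1 / s * t ^+ n * (p ^+ 2 * s') =
   2 * rho ^+ n.+1 * t ^+ n * ((p * p) * (s' / s)) by field; rewrite gt_eqF.
apply: ler_wpM2l; first by rewrite !mulr_ge0 // exprn_ge0.
rewrite -[leLHS]mulr1; apply: ler_pM => //.
- by rewrite !mulr_ge0.
- by apply: ler_pM => //; rewrite mulr_ge0.
- by rewrite ler_pdivlMr // mul1r.
Qed.

(** The Chebyshev coefficient of order k of q is proportional to the integral of
    cos^(2 k) / r, where r = sqrt (1 - rho^2 cos^2 phi), so that 1 - sqrt Y q is
    2 / pi times the integral of sqrt Y / r times the truncation error of the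
    Poisson kernel. *)
Lemma weighted_inv_sqrt_approx (R : realType) (rho : R) (n : nat) :
  0 <= rho < 1 ->
  exists q : {poly R}, (size q <= n.+1)%N /\
    forall X, -1 <= X <= 1 ->
      `|1 - Num.sqrt (1 + 2 * rho * X + rho ^+ 2) * q.[X]|
      <= 2 / pi * (2 * rho ^+ n.+1 / Num.sqrt (1 - rho ^+ 2))
         * cosn_int R n.*2.
Proof.
move=> rho01; have pi0 := pi_gt0 R.
pose r (y : R) := Num.sqrt (1 - rho ^+ 2 * cos y ^+ 2).
have /choice[F FD] (k : nat) : exists F : R -> R, forall x, 0 <= x <= pi / 2 ->
    is_derive x 1 F ((cos x ^+ 2) ^+ k / r x).
  by apply: continuous_antiderivative; exact: continuous_weight.
have cancel_pi (p y Q : R) : 0 < p -> p / 2 * (y * (2 / p * Q)) = y * Q.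
  by move=> p0; field; rewrite gt_eqF.
pose e k : R := 2 - (k == 0%N)%:R.
pose mom k := F k (pi / 2) - F k 0.
exists ((2 / pi) *: \sum_(k < n.+1) (e k * (- rho) ^+ k * mom k) *: cheb R k); split.
  rewrite (leq_trans (size_scale_leq _ _)) // (leq_trans (size_sum _ _ _)) //.
  apply/bigmax_leqP => k _; rewrite (leq_trans (size_scale_leq _ _)) //.
  by rewrite (leq_trans (size_cheb _ _)) // ltnS -ltnS ltn_ord.
move=> X X1; have [Phi [PhiE PhiD]] := arc_primitive rho01 X1.
set sY := Num.sqrt _; pose c k := sY * (e k * (- rho) ^+ k * (cheb R k).[X]).
pose S y := \sum_(k < n.+1) c k * F k y.
pose K := 2 * rho ^+ n.+1 / Num.sqrt (1 - rho ^+ 2).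
have SE : S (pi / 2) - S 0 = pi / 2 *
    (sY * ((2 / pi) *:
      \sum_(k < n.+1) (e k * (- rho) ^+ k * mom k) *: cheb R k).[X]).
  rewrite hornerZ horner_sum (cancel_pi pi) //.
  rewrite mulr_sumr -sumrB; apply: eq_bigr => k _.
  by rewrite hornerZ /c /mom; ring.
pose p x : R := 1 + 2 * (rho * cos x ^+ 2) * X + (rho * cos x ^+ 2) ^+ 2.
(* Phi collects the full kernel and S its truncation. *)
have main : `|(Phi (pi / 2) - S (pi / 2)) - (Phi 0 - S 0)| <=
    K * cosn_prim n.*2 (pi / 2) - K * cosn_prim n.*2 0.
  apply: (@ler_dist_derive _ (fun y => Phi y - S y)
    (fun x => sY * (1 - (rho * cos x ^+ 2) ^+ 2) / (p x * r x)
       - \sum_(k < n.+1) c k * ((cos x ^+ 2) ^+ k / r x))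
    (fun y => K * cosn_prim n.*2 y) (fun x => K * cos x ^+ n.*2)).
  - by lra.
  - move=> x xb; apply: is_deriveB; first exact: PhiD.
    exact: (@is_derive_bigsum _ n.+1 F c (fun k => (cos x ^+ 2) ^+ k / r x) x
      (fun k => FD k x xb)).
  - by move=> x xb; apply: is_deriveZ; exact: is_derive_cosn_prim.
  move=> x xb; set t := cos x ^+ 2; set u := rho * t.
  have t01 : 0 <= t <= 1 by rewrite sqr_ge0 cos_sqr_le1.
  have [t0 t1] := andP t01; have [rho0 rho1] := andP rho01.
  have u0 : 0 <= u by rewrite mulr_ge0.
  have u1 : u < 1 by rewrite (le_lt_trans _ rho1) // ler_piMr.
  have p0 : p x != 0.
    have -> : p x = (1 - u) ^+ 2 + 2 * u * (1 + X) by rewrite /p -/t -/u; ring.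
    rewrite gt_eqF // ltr_wpDr ?exprn_gt0 ?subr_gt0 // mulr_ge0 ?(mulr_ge0 _ u0) //.
    by lra.
  have r0 : r x != 0 by rewrite gt_eqF // sqrtr_gt0; exact: weight_gt0.
  have -> : sY * (1 - u ^+ 2) / (p x * r x)
       - \sum_(k < n.+1) c k * (t ^+ k / r x)
    = sY * (2 * (- u) ^+ n.+1 * ((cheb R n.+1).[X] + u * (cheb R n).[X]))
       / (p x * r x).
    have -> : \sum_(k < n.+1) c k * (t ^+ k / r x) =
        sY / r x * \sum_(k < n.+1) e k * (- u) ^+ k * (cheb R k).[X].
      rewrite mulr_sumr; apply: eq_bigr => k _.
      rewrite /c /u -mulNr [in RHS]exprMn.
      by move: (t ^+ k) ((- rho) ^+ k) (cheb R k).[X] (e k) => a1 a2 a3 a4; field.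
    have := cheb_geometric_sum n X u; rewrite -/(p x).
    set G := \sum_(k < n.+1) _; move=> GE.
    have -> : sY / r x * G = sY * (p x * G) / (p x * r x) by field; rewrite r0.
    by rewrite GE; field; rewrite r0.
  rewrite -mul2n exprM -/t.
  exact: remainder_density_le (cheb_comb_le _ _ X1).
have pi2 : 0 < pi / 2 :> R by lra.
rewrite -(ler_pM2l pi2) -{1}(gtr0_norm pi2) -normrM mulrBr mulr1 -SE.
have -> : pi / 2 - (S (pi / 2) - S 0) = Phi (pi / 2) - S (pi / 2) - (Phi 0 - S 0).
  by rewrite -[X in X - _ = _]PhiE; ring.
apply: le_trans main _.
rewrite -mulrBr -/K -/(cosn_int R n.*2) -(mulrA (2 / pi)).
by have := cancel_pi pi 1 (K * cosn_int R n.*2) pi0; rewrite !mul1r => ->.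
Qed.

(** Oddness reduces the problem to |x|, and x^2 = ((1 + a) / 2)^2 (1 + 2 rho X +
    rho^2) to [weighted_inv_sqrt_approx]. Finally 1 - rho^2 = 4 a / (1 + a)^2 and
    the Wallis bound give the constant (1 - a) / sqrt (pi a). *)
Lemma sign_approx (R : realType) (a : R) (n : nat) : 0 < a <= 1 ->
  exists p : {poly R}, (size p <= n.+2.*2)%N /\
    forall x, a <= `|x| <= 1 ->
      `|Num.sg x - p.[x]| <=
      (1 - a) / Num.sqrt (pi * a) / Num.sqrt n.+1%:R
        * ((1 - a) / (1 + a)) ^+ n.+1.
Proof.
move=> /andP[a0 a1]; pose rho := (1 - a) / (1 + a).
have a1_neq0 : 1 + a != 0 by rewrite gt_eqF // ltr_wpDl.
have rho01 : 0 <= rho < 1.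
  by rewrite divr_ge0 ?ltr_pdivrMr /=; lra.
have [q [sq qE]] := weighted_inv_sqrt_approx n.+1 rho01.
(* The affine map from [a^2, 1] onto [-1, 1], composed with the square. *)
pose Xp : {poly R} := (1 - a ^+ 2)^-1 *: (2 *: 'X^2 - (1 + a ^+ 2)%:P).
have sXp : (size Xp <= 3)%N.
  rewrite (leq_trans (size_scale_leq _ _)) // (leq_trans (size_polyD _ _)) //.
  rewrite geq_max (leq_trans (size_scale_leq _ _)) ?size_polyXn // size_polyN.
  by rewrite (leq_trans (size_polyC_leq1 _)).
exists ((2 / (1 + a)) *: ('X * (q \Po Xp))); split.
  rewrite (leq_trans (size_scale_leq _ _)) // mulrC.
  rewrite (leq_trans (size_polyMleq _ _)) // size_polyX addn2 /=.
  rewrite doubleS ltnS (leq_trans (size_comp_poly_leq _ _)) // ltnS.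
  have sq' : ((size q).-1 <= n.+1)%N by case: (size q) sq.
  have sXp' : ((size Xp).-1 <= 2)%N by case: (size Xp) sXp.
  by rewrite -muln2 leq_mul.
move=> x /andP[ax x1].
have x0 : x != 0 by rewrite -normr_gt0 (lt_le_trans a0).
have x2 : x ^+ 2 = `|x| ^+ 2 by rewrite real_normK ?num_real.
pose X := Xp.[x].
have XE : X = (1 - a ^+ 2)^-1 * (2 * `|x| ^+ 2 - (1 + a ^+ 2)).
  by rewrite /X /Xp !(hornerZ, hornerD, hornerN, hornerC, hornerXn) x2.
have [X1 YE] : -1 <= X <= 1 /\
    Num.sqrt (1 + 2 * rho * X + rho ^+ 2) = 2 / (1 + a) * `|x|.
  (* For a = 1 the affine map degenerates: rho = 0, and X = 0 because the
     inverse of 0 is 0, so the identity for Y still holds. *)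
  have [aE1|a_neq1] := eqVneq a 1.
    have -> : `|x| = 1 by apply: le_anti; rewrite x1 -aE1.
    have -> : X = 0 by rewrite XE aE1 expr1n subrr invr0 mul0r.
    rewrite /rho aE1 subrr mul0r mulr0 mul0r expr0n /= !addr0 sqrtr1.
    by split; [lra | field].
  have a_lt1 : a < 1 by rewrite lt_neqAle a_neq1.
  have d_gt0 : 0 < 1 - a ^+ 2 by rewrite subr_gt0 expr_lt1 // ltW.
  have y_ge : a ^+ 2 <= `|x| ^+ 2 by rewrite ler_pXn2r ?nnegrE // ltW.
  have y_le : `|x| ^+ 2 <= 1 by rewrite expr_le1.
  split.
    rewrite XE mulrC ler_pdivlMr // ler_pdivrMr //; apply/andP; split; lra.
  have -> : 1 + 2 * rho * X + rho ^+ 2 = (2 / (1 + a) * `|x|) ^+ 2.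
    rewrite XE /rho; move: (`|x|) => y.
    by field; rewrite a1_neq0 gt_eqF.
  by rewrite sqrtr_sqr ger0_norm // mulr_ge0 // divr_ge0; lra.
have -> : Num.sg x - ((2 / (1 + a)) *: ('X * (q \Po Xp))).[x]
    = Num.sg x * (1 - Num.sqrt (1 + 2 * rho * X + rho ^+ 2) * q.[X]).
  rewrite hornerZ hornerM hornerX horner_comp -/X YE.
  by move: (Num.sg x) q.[X] (numEsg x) => g Q xE; rewrite {1}xE; ring.
rewrite normrM normr_sg x0 mul1r; apply: le_trans (qE X X1) _.
have pi0 := pi_gt0 R; have n0 : 0 < n.+1%:R :> R by rewrite ltr0n.
have W_le : cosn_int R n.+1.*2 <= Num.sqrt pi / (2 * Num.sqrt n.+1%:R).
  have W0 : 0 <= cosn_int R n.+1.*2.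
    by rewrite doubleS; have /andP[] := cosn_int_bound R n.*2.+1.
  rewrite -(ger0_norm W0) -sqrtr_sqr -[leRHS]ger0_norm; last first.
    by rewrite divr_ge0 ?mulr_ge0 ?sqrtr_ge0.
  rewrite -[leRHS]sqrtr_sqr ler_wsqrtr // expr_div_n exprMn.
  rewrite !sqr_sqrtr ?(ltW pi0) ?(ltW n0) //.
  rewrite doubleS (le_trans (cosn_int_sqr_le _ _)) // -doubleS -muln2 natrM.
  by rewrite (_ : 2 * (n.+1%:R * 2) = 2 ^+ 2 * n.+1%:R :> R) //; ring.
have sE : Num.sqrt (1 - rho ^+ 2) = 2 * Num.sqrt a / (1 + a).
  have -> : 1 - rho ^+ 2 = (2 * Num.sqrt a / (1 + a)) ^+ 2.
    by rewrite [RHS]expr_div_n [in RHS]exprMn sqr_sqrtr ?(ltW a0) // /rho; field.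
  by rewrite sqrtr_sqr ger0_norm // divr_ge0 ?mulr_ge0 ?sqrtr_ge0 //; lra.
rewrite sE sqrtrM ?(ltW pi0) //.
apply: le_trans (ler_wpM2l _ W_le) _.
  have [r0 _] := andP rho01.
  have a1_ge0 : 0 <= 1 + a by lra.
  apply: mulr_ge0; first by rewrite divr_ge0 // ltW.
  apply: divr_ge0; first by rewrite mulr_ge0 // exprn_ge0.
  by rewrite divr_ge0 // mulr_ge0 // sqrtr_ge0.
rewrite -/rho (exprS rho n.+1) le_eqVlt; apply/orP; left; apply/eqP.
have -> : 2 / pi = 2 / Num.sqrt pi ^+ 2 :> R by rewrite sqr_sqrtr // ltW.
have : Num.sqrt pi != 0 :> R by rewrite gt_eqF // sqrtr_gt0.
have : Num.sqrt a != 0 by rewrite gt_eqF // sqrtr_gt0.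
have : Num.sqrt n.+1%:R != 0 :> R by rewrite gt_eqF // sqrtr_gt0.
rewrite {1}/rho; move: (rho ^+ n.+1) (Num.sqrt pi) (Num.sqrt a) => g p s.
move: (Num.sqrt n.+1%:R) => t t0 s0 p0.
by field; rewrite a1_neq0 t0 s0 p0.
Qed.

Lemma step_sg (R : realType) (mu t : R) : step mu t = (1 - Num.sg (t - mu)) / 2.
Proof.
rewrite /step; case: ltgtP => [tmu|mut|->].
- by rewrite ltr0_sg ?subr_lt0 //; field.
- by rewrite gtr0_sg ?subr_gt0 //; ring.
- by rewrite subrr sgr0; field.
Qed.

Lemma step_approx (R : realType) (mu delta Delta : R) (n : nat) :
  0 < delta <= Delta ->
  let theta := delta / Delta in
  exists p : {poly R}, (size p <= n.+2.*2)%N /\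
    forall t, delta <= `|t - mu| <= Delta ->
      `|step mu t - p.[t]| <=
      (1 - theta) / Num.sqrt (pi * theta) / Num.sqrt n.+1%:R
        * ((1 - theta) / (1 + theta)) ^+ n.+1 / 2.
Proof.
move=> /andP[d0 dD] theta; have D0 := lt_le_trans d0 dD.
have [|p [sp pE]] := @sign_approx R theta n.
  by rewrite divr_gt0 //= ler_pdivrMr // mul1r.
pose s : {poly R} := Delta^-1 *: ('X - mu%:P).
exists (2^-1 *: (1 - (p \Po s))); split.
  have ss : ((size s).-1 <= 1)%N.
    have : (size s <= 2)%N.
      by rewrite (leq_trans (size_scale_leq _ _)) ?size_XsubC.
    by case: (size s).
  rewrite (leq_trans (size_scale_leq _ _)) // (leq_trans (size_polyD _ _)) //.
  rewrite geq_max size_poly1 size_polyN doubleS ltn0Sn /=.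
  rewrite (leq_trans (size_comp_poly_leq _ _)) // ltnS.
  rewrite (leq_trans (leq_mul (leqnn _) ss)) // muln1.
  by rewrite doubleS in sp; case: (size p) sp.
move=> t tb.
have sE : s.[t] = (t - mu) / Delta by rewrite /s hornerZ hornerXsubC mulrC.
clearbody s.
have sb : theta <= `|s.[t]| <= 1.
  rewrite sE normrM normfV (gtr0_norm D0) ler_pM2r ?invr_gt0 //.
  by rewrite ler_pdivrMr // mul1r.
have sgE : Num.sg (t - mu) = Num.sg s.[t].
  by rewrite sE sgrM [Num.sg Delta^-1]gtr0_sg ?invr_gt0 // mulr1.
rewrite step_sg sgE hornerZ hornerD hornerN horner_comp hornerC.
have -> : (1 - Num.sg s.[t]) / 2 - 2^-1 * (1 - p.[s.[t]]) =
    (- (Num.sg s.[t] - p.[s.[t]])) / 2 by field.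
rewrite normrM normrN (gtr0_norm (_ : 0 < 2^-1)) ?invr_gt0 //.
by rewrite ler_pM2r ?invr_gt0 // pE.
Qed.

(** * Quadratic forms of functions of symmetric matrices *)

Lemma sqr_norm2 (R : realType) (n : nat) (x : 'cV[R]_n) :
  norm2 x ^+ 2 = \sum_i x i 0 ^+ 2.
Proof. by rewrite sqr_sqrtr // sumr_ge0 // => i _; exact: sqr_ge0. Qed.

Lemma quadform_eigendec (R : realType) (n : nat) (Q : 'M[R]_n) (d : 'rV[R]_n)
    (x : 'cV[R]_n) :
  (x^T *m (Q *m diag_mx d *m Q^T) *m x) 0 0 =
  \sum_i d 0 i * (Q^T *m x) i 0 ^+ 2.
Proof.
have -> : x^T *m (Q *m diag_mx d *m Q^T) *m x =
    (Q^T *m x)^T *m (diag_mx d *m (Q^T *m x)).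
  by rewrite trmx_mul trmxK !mulmxA.
by rewrite mul_diag_mx mxE; apply: eq_bigr => i _; rewrite !mxE; ring.
Qed.

Lemma quadform_mxfun (R : realType) (f : R -> R) (n : nat) (B Q : 'M[R]_n)
    (d : 'rV[R]_n) (x : 'cV[R]_n) : eigendec B Q d ->
  (x^T *m mxfun f B *m x) 0 0 = \sum_i f (d 0 i) * (Q^T *m x) i 0 ^+ 2.
Proof.
move=> /(mxfunE f) ->; rewrite quadform_eigendec.
by apply: eq_bigr => i _; rewrite mxE.
Qed.

Lemma sum_sqr_orthogonal (R : realType) (n : nat) (Q : 'M[R]_n)
    (x : 'cV[R]_n) : Q^T *m Q = 1%:M ->
  \sum_i (Q^T *m x) i 0 ^+ 2 = norm2 x ^+ 2.
Proof.
move=> /mulmx1C QQ; rewrite sqr_norm2.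
transitivity (((Q^T *m x)^T *m (Q^T *m x)) 0 0).
  by rewrite [RHS]mxE; apply: eq_bigr => i _; rewrite [in RHS]mxE -expr2.
rewrite trmx_mul trmxK -mulmxA (mulmxA Q) QQ mul1mx mxE.
by apply: eq_bigr => i _; rewrite mxE -expr2.
Qed.

Lemma eigendec_exp (R : realType) (n : nat) (B Q : 'M[R]_n) (d : 'rV[R]_n)
    (l : nat) : eigendec B Q d ->
  B ^+ l = Q *m diag_mx (map_mx (fun t => t ^+ l) d) *m Q^T.
Proof.
move=> [QQ BE]; elim: l => [|l IHl].
  rewrite expr0 (_ : map_mx _ d = const_mx 1); last first.
    by apply/rowP => i; rewrite !mxE expr0.
  by rewrite diag_const_mx mulmx1 (mulmx1C QQ).
rewrite exprS IHl -[LHS]/(B *m _) {1}BE.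
rewrite !mulmxA -(mulmxA _ Q^T Q) QQ mulmx1 -(mulmxA Q) mulmx_diag.
by congr (Q *m diag_mx _ *m _); apply/rowP => i; rewrite !mxE exprS.
Qed.

Lemma eigendec_eigenvalue (R : realType) (n : nat) (B Q : 'M[R]_n)
    (d : 'rV[R]_n) (i : 'I_n) : eigendec B Q d -> eigenvalue B (d 0 i).
Proof.
move=> [QQ BE]; apply/eigenvalueP; exists (row i Q^T).
  rewrite -row_mul BE !mulmxA QQ mul1mx mul_diag_mx.
  by apply/rowP => j; rewrite !mxE.
apply/eqP => r0; have : row i (Q^T *m Q) = 0 by rewrite row_mul r0 mul0mx.
by rewrite QQ => /rowP/(_ i); rewrite !mxE eqxx => /eqP; rewrite oner_eq0.
Qed.

Lemma quadform_poly (R : realType) (p : {poly R}) (n : nat) (B : 'M[R]_n)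
    (x : 'cV[R]_n) : B^T = B ->
  (x^T *m mxfun (horner p) B *m x) 0 0 =
  \sum_(l < size p) p`_l * (x^T *m B ^+ l *m x) 0 0.
Proof.
move=> /eigendec_exists[Q [d BE]]; rewrite (quadform_mxfun _ _ BE).
transitivity (\sum_i \sum_(l < size p)
    p`_l * (d 0 i ^+ l * (Q^T *m x) i 0 ^+ 2)).
  apply: eq_bigr => i _; rewrite horner_coef mulr_suml.
  by apply: eq_bigr => l _; rewrite -mulrA.
rewrite exchange_big; apply: eq_bigr => l _ /=.
rewrite (eigendec_exp l BE) quadform_eigendec mulr_sumr.
by apply: eq_bigr => i _; rewrite !mxE.
Qed.

Lemma expmx_sym (R : realType) (n : nat) (B : 'M[R]_n) (l : nat) :
  B^T = B -> (B ^+ l)^T = B ^+ l.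
Proof.
move=> BT; elim: l => [|l IHl]; first by rewrite expr0 trmx1.
rewrite exprSr -[X in X^T]/(_ *m _) trmx_mul IHl BT.
by rewrite -[LHS]/(B * _) -exprS exprSr.
Qed.

(** In an eigenbasis both quadratic forms are sums over the eigenvalues with the
    same nonnegative weights, of total mass |x|^2. *)
Lemma quadform_mxfun_dist (R : realType) (f g : R -> R) (eps : R) (n : nat)
    (B : 'M[R]_n) (x : 'cV[R]_n) : B^T = B ->
  (forall t, eigenvalue B t -> `|f t - g t| <= eps) ->
  `|(x^T *m mxfun f B *m x) 0 0 - (x^T *m mxfun g B *m x) 0 0|
    <= eps * norm2 x ^+ 2.
Proof.
move=> /eigendec_exists[Q [d BE]] fg; have [QQ _] := BE.
rewrite !(quadform_mxfun _ _ BE) -sumrB -(sum_sqr_orthogonal x QQ) mulr_sumr.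
apply: le_trans (ler_norm_sum _ _ _) _; apply: ler_sum => i _.
rewrite -mulrBl normrM (ger0_norm (sqr_ge0 _)) ler_wpM2r ?sqr_ge0 //.
exact/fg/eigendec_eigenvalue/BE.
Qed.

(** * Exactness and error of the Lanczos approximation *)

Lemma norm2_e1 (R : realType) (m : nat) : (0 < m)%N -> norm2 (e1 R m) = 1.
Proof.
case: m => // m _; rewrite /norm2 (bigD1 ord0) //= mxE expr1n.
rewrite big1 ?addr0 ?sqrtr1 // => i i0; rewrite mxE.
by rewrite -[_ == _]/(i == ord0) (negbTE i0) expr0n.
Qed.

Lemma lanczos_norm2_neq0 (R : realType) (n m : nat) (A : 'M[R]_n)
    (x : 'cV[R]_n) (V : 'M[R]_(n, m)) :
  lanczos_basis A x V -> (0 < m)%N -> norm2 x != 0.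
Proof.
move=> [VV Ve _] m_gt0; apply/eqP => x0.
have : V^T *m (V *m e1 R m) = 0 by rewrite Ve x0 invr0 scale0r mulmx0.
rewrite mulmxA VV mul1mx => e0; move: (norm2_e1 R m_gt0).
rewrite e0 /norm2 big1 ?sqrtr0.
  by move=> /esym/eqP; rewrite oner_eq0.
by move=> i _; rewrite mxE expr0n.
Qed.

(** V V^T is the orthogonal projection onto the Krylov space. *)
Lemma lanczos_projection (R : realType) (n m : nat) (A : 'M[R]_n)
    (x : 'cV[R]_n) (V : 'M[R]_(n, m)) (l : nat) :
  lanczos_basis A x V -> (l < m)%N ->
  V *m V^T *m (A ^+ l *m x) = A ^+ l *m x.
Proof.
move=> [VV _ /(_ m (leqnn m))]; set X := [seq _ | _ <- _ & _] => VX lm.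
have : A ^+ l *m x \in <<X>>%VS.
  rewrite VX; apply: memv_span; apply/mapP; exists l => //.
  by rewrite mem_iota.
move=> /(coord_span (X := in_tuple X)) ->.
rewrite mulmx_sumr; apply: eq_bigr => i _; rewrite -scalemxAr; congr (_ *: _).
have /mapP[j _ ->] : (in_tuple X)`_i \in X by rewrite mem_nth.
by rewrite colE -mulmxA (mulmxA _ V) VV mul1mx.
Qed.

(** Up to order m - 1 the projection in T = V^T A V is invisible, since A^(l+1) x
    is still in the Krylov space. *)
Lemma lanczos_krylov (R : realType) (n m : nat) (A : 'M[R]_n)
    (x : 'cV[R]_n) (V : 'M[R]_(n, m)) (l : nat) :
  lanczos_basis A x V -> (l < m)%N ->
  A ^+ l *m x = norm2 x *: (V *m (lanczos_mx A V ^+ l *m e1 R m)).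
Proof.
set T := lanczos_mx A V; move=> VP; elim: l => [|l IHl] lm.
  have [_ Ve _] := VP; rewrite !expr0 -[1]/(1%:M) !mul1mx Ve scalerA.
  by rewrite mulfV ?(lanczos_norm2_neq0 VP) // scale1r.
rewrite -(lanczos_projection VP lm) exprS -[A * _]/(A *m _) -(mulmxA A).
rewrite IHl ?(ltnW lm) //.
by rewrite -!scalemxAr exprS -[T * _]/(T *m _) {2}/T /lanczos_mx !mulmxA.
Qed.

Lemma lanczos_mx_sym (R : realType) (n m : nat) (A : 'M[R]_n)
    (V : 'M[R]_(n, m)) : A^T = A -> (lanczos_mx A V)^T = lanczos_mx A V.
Proof. by move=> A_sym; rewrite /lanczos_mx !trmx_mul trmxK A_sym mulmxA. Qed.

(** Gauss quadrature exactness: l is i + j or i + 1 + j with i, j < m, so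
    x^T A^l x is (A^i x)^T (A^j x) or (A^i x)^T A (A^j x), where
    [lanczos_krylov] applies to both factors. *)
Lemma lanczos_moment (R : realType) (n m : nat) (A : 'M[R]_n)
    (x : 'cV[R]_n) (V : 'M[R]_(n, m)) (l : nat) :
  lanczos_basis A x V -> A^T = A -> (l < m.*2)%N ->
  (x^T *m A ^+ l *m x) 0 0 =
  norm2 x ^+ 2 * ((e1 R m)^T *m lanczos_mx A V ^+ l *m e1 R m) 0 0.
Proof.
set T := lanczos_mx A V; move=> VP A_sym lm; have [VV _ _] := VP.
have dotZ (c : R) (a b : 'cV[R]_n) :
    ((c *: a)^T *m (c *: b)) 0 0 = c ^+ 2 * (a^T *m b) 0 0.
  by rewrite !mxE mulr_sumr; apply: eq_bigr => i _; rewrite !mxE; ring.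
suff [i [j [im [jm [lE|lE]]]]] : exists i j, (i < m)%N /\ (j < m)%N /\
    (l = (i + j)%N \/ l = (i + j).+1).
- have -> : x^T *m A ^+ l *m x = (A ^+ i *m x)^T *m (A ^+ j *m x).
    rewrite trmx_mul (expmx_sym _ A_sym) lE exprD -[A ^+ i * _]/(_ *m _).
    by rewrite !mulmxA.
  rewrite !(lanczos_krylov VP) // dotZ; congr (_ * _).
  rewrite lE exprD -[T ^+ i * _]/(_ *m _).
  rewrite !trmx_mul (expmx_sym _ (lanczos_mx_sym V A_sym)) !mulmxA.
  by rewrite -(mulmxA _ V^T) VV mulmx1.
- have -> : x^T *m A ^+ l *m x = (A ^+ i *m x)^T *m (A *m (A ^+ j *m x)).
    rewrite trmx_mul (expmx_sym _ A_sym) lE -addnS exprD exprS.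
    by rewrite -[A ^+ i * _]/(_ *m (_ *m _)) !mulmxA.
  rewrite !(lanczos_krylov VP) // -(scalemxAr _ A) dotZ; congr (_ * _).
  rewrite lE -addnS exprD exprS -[T ^+ i * _]/(_ *m (_ *m _)).
  have TE (z : 'cV[R]_m) : V^T *m (A *m (V *m z)) = T *m z.
    by rewrite /T /lanczos_mx !mulmxA.
  by rewrite !trmx_mul (expmx_sym _ (lanczos_mx_sym V A_sym)) -!mulmxA TE.
have lE := odd_double_half l; exists l./2.
have half_lt : (l./2 < m)%N.
  by rewrite -ltn_double (leq_ltn_trans _ lm) // -{2}lE leq_addl.
case: (odd l) lE => /= lE.
  by exists l./2; do 2!split => //; right; rewrite addnn -add1n lE.
by exists l./2; do 2!split => //; left; rewrite addnn -{1}lE.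
Qed.

Lemma lanczos_approx_poly (R : realType) (n m : nat) (A : 'M[R]_n)
    (x : 'cV[R]_n) (V : 'M[R]_(n, m)) (p : {poly R}) :
  lanczos_basis A x V -> A^T = A -> (size p <= m.*2)%N ->
  lanczos_approx (horner p) A x V = (x^T *m mxfun (horner p) A *m x) 0 0.
Proof.
move=> VP AT sp; rewrite quadform_poly // /lanczos_approx.
rewrite quadform_poly; last exact: lanczos_mx_sym.
rewrite mulr_sumr; apply: eq_bigr => l _.
rewrite (lanczos_moment VP AT) ?(leq_trans (ltn_ord l)) //.
by rewrite mulrCA.
Qed.

Lemma lanczos_approx_dist (R : realType) (n m : nat) (A : 'M[R]_n)
    (x : 'cV[R]_n) (V : 'M[R]_(n, m)) (f : R -> R) (p : {poly R}) (eps : R) :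
  lanczos_basis A x V -> (0 < m)%N -> A^T = A -> (size p <= m.*2)%N ->
  (forall t, eigenvalue A t -> `|f t - p.[t]| <= eps) ->
  (forall t, eigenvalue (lanczos_mx A V) t -> `|f t - p.[t]| <= eps) ->
  `|(x^T *m mxfun f A *m x) 0 0 - lanczos_approx f A x V|
    <= 2 * eps * norm2 x ^+ 2.
Proof.
move=> VP m0 AT sp fA fT.
have dA := quadform_mxfun_dist x AT fA.
have dT := quadform_mxfun_dist (e1 R m) (lanczos_mx_sym V AT) fT.
rewrite norm2_e1 // expr1n mulr1 in dT.
have := lanczos_approx_poly VP AT sp; rewrite /lanczos_approx.
have := sqr_ge0 (norm2 x); move: (norm2 x ^+ 2) dA dT => s.
set a := (_ *m _ *m _) 0 0; set b := (_ *m mxfun (horner p) A *m _) 0 0.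
set c := (_ *m _ *m _) 0 0; set d := (_ *m mxfun (horner p) _ *m _) 0 0.
move=> dA dT s0 sb.
have -> : a - s * c = (a - b) - s * (c - d) by rewrite -sb; ring.
rewrite (le_trans (ler_normB _ _)) // normrM (ger0_norm s0).
have -> : 2 * eps * s = eps * s + s * eps by ring.
by rewrite lerD // ler_wpM2l.
Qed.

(** If v is a row eigenvector of V^T A V, its eigenvalue is the Rayleigh quotient
    of A at V v^T, hence a weighted mean of eigenvalues of A. *)
Lemma ritz_value_bounds (R : realType) (n m : nat) (A : 'M[R]_n)
    (V : 'M[R]_(n, m)) (lo hi : R) : A^T = A -> V^T *m V = 1%:M ->
  (forall t, eigenvalue A t -> lo <= t <= hi) ->
  forall t, eigenvalue (lanczos_mx A V) t -> lo <= t <= hi.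
Proof.
move=> AT VV Ab t /eigenvalueP[v vT v0].
have [Q [d AE]] := eigendec_exists AT; have [QQ _] := AE.
pose w := V *m v^T.
have s_gt0 : 0 < (v *m v^T) 0 0.
  rewrite lt_def row_sqr sumr_ge0 ?andbT => [|i _]; last exact: sqr_ge0.
  by rewrite -row_sqr; apply: contraNneq v0 => /row_sqr_eq0 ->.
have sE : \sum_i (Q^T *m w) i 0 ^+ 2 = (v *m v^T) 0 0.
  rewrite (sum_sqr_orthogonal _ QQ) sqr_norm2.
  transitivity ((w^T *m w) 0 0).
    by rewrite mxE; apply: eq_bigr => i _; rewrite [w^T 0 i]mxE expr2.
  by rewrite /w trmx_mul trmxK -mulmxA (mulmxA _ V) VV mul1mx.
have tE : \sum_i d 0 i * (Q^T *m w) i 0 ^+ 2 = t * (v *m v^T) 0 0.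
  rewrite -quadform_eigendec -(proj2 AE) /w trmx_mul trmxK.
  have -> : v *m V^T *m A *m (V *m v^T) = v *m lanczos_mx A V *m v^T.
    by rewrite /lanczos_mx !mulmxA.
  by rewrite vT -scalemxAl mxE.
have Ad i : lo <= d 0 i <= hi by apply: Ab; exact: eigendec_eigenvalue AE.
rewrite -(ler_pM2r s_gt0) -[t <= hi](ler_pM2r s_gt0) -tE -sE !mulr_sumr.
apply/andP; split; apply: ler_sum => i _; rewrite ler_wpM2r ?sqr_ge0 //.
  by have /andP[] := Ad i.
by have /andP[] := Ad i.
Qed.

Lemma eigenvalue_mem (R : realType) (n : nat) (A : 'M[R]_n) (lam : n.-tuple R)
    (t : R) : eigenvalues_of A lam -> eigenvalue A t = (t \in lam).
Proof.
by move=> [_ cA]; rewrite eigenvalue_root_char cA root_prod_XsubC.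
Qed.

Theorem proposition3p6 (R : realType) (n : nat) (A : 'M[R]_n)
    (lam : n.-tuple R) (mu : R) (k : nat) (x : 'cV[R]_n) (m : nat)
    (V : 'M[R]_(n, m))
    (A_sym : A^T = A)
    (lamP : eigenvalues_of A lam)
    (mu_neig : ~~ eigenvalue A mu)
    (kE : k = count (fun l : R => l < mu) lam)
    (k_bounds : (1 <= k <= n - 1)%N)
    (m_ge2 : (2 <= m)%N)
    (VP : lanczos_basis A x V)
    (no_eig_gap : forall t : R, lam`_k.-1 < t < lam`_k ->
       ~~ eigenvalue (lanczos_mx A V) t) :
  let theta := rel_gap lam mu k in
  `| (x^T *m mxfun (step mu) A *m x) ord0 ord0
     - lanczos_approx (step mu) A x V |
  <= Ctheta theta * norm2 x ^+ 2 / Num.sqrt (m - 1)%:R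
     * ((1 - theta) / (1 + theta)) ^+ (m - 1).
Proof.
case: m V m_ge2 VP no_eig_gap => [|[|m]] V // _ VP no_eig_gap.
cbv zeta; set theta := rel_gap lam mu k.
rewrite subn1 /=; have [VV _ _] := VP; have [lam_sorted _] := lamP.
have [/andP[k0 kn] sz] := (k_bounds, size_tuple lam).
have k_lt : (k < n)%N by lia.
have lo_lt : lam`_k.-1 < mu.
  by apply: nth_count_lt lam_sorted _; rewrite -kE prednK.
have hi_gt : mu < lam`_k.
  rewrite lt_neqAle nth_count_ge ?andbT ?sz //; last by rewrite -kE leqnn.
  apply: contraNneq mu_neig => ->; rewrite (eigenvalue_mem _ lamP) mem_nth //.
  by rewrite sz.
have eigA t : eigenvalue A t -> [/\ lam`_0 <= t <= lam`_n.-1 &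
    (t <= lam`_k.-1) || (lam`_k <= t)].
  rewrite (eigenvalue_mem _ lamP) => /(nthP 0)[i]; rewrite sz => i_lt <-.
  have mono := sorted_leq_nth le_trans lexx 0 lam_sorted.
  split; first by rewrite !mono ?inE ?sz //; lia.
  case: (ltnP i k) => ik; first by rewrite mono ?inE ?sz //; lia.
  by rewrite [X in _ || X]mono ?inE ?sz ?orbT //; lia.
have eigT t : eigenvalue (lanczos_mx A V) t -> [/\ lam`_0 <= t <= lam`_n.-1 &
    (t <= lam`_k.-1) || (lam`_k <= t)].
  move=> tT; split.
    by apply: ritz_value_bounds A_sym VV _ t tT => s /eigA[].
  by apply: contraLR tT; rewrite negb_or -!ltNge => /no_eig_gap.
pose delta := Num.min `|lam`_k.-1 - mu| `|lam`_k - mu|.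
pose Delta := Num.max `|lam`_0 - mu| `|lam`_n.-1 - mu|.
(* All nodes lie in the two bands on which the step is approximated. *)
have dist t : [/\ lam`_0 <= t <= lam`_n.-1 &
    (t <= lam`_k.-1) || (lam`_k <= t)] -> delta <= `|t - mu| <= Delta.
  move=> [/andP[t_ge t_le] /orP[tk|tk]]; rewrite /delta /Delta ge_min le_max.
    have -> : `|t - mu| = mu - t by rewrite ltr0_norm ?opprB // subr_lt0; lra.
    have -> : `|lam`_k.-1 - mu| = mu - lam`_k.-1.
      by rewrite ltr0_norm ?opprB // subr_lt0.
    have -> : `|lam`_0 - mu| = mu - lam`_0.
      by rewrite ltr0_norm ?opprB // subr_lt0; lra.
    by rewrite !lerB.
  have -> : `|t - mu| = t - mu by rewrite gtr0_norm // subr_gt0; lra.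
  have -> : `|lam`_k - mu| = lam`_k - mu by rewrite gtr0_norm // subr_gt0.
  have -> : `|lam`_n.-1 - mu| = lam`_n.-1 - mu.
    by rewrite gtr0_norm // subr_gt0; lra.
  by rewrite !lerB // !orbT.
have eig_lo : eigenvalue A lam`_k.-1.
  by rewrite (eigenvalue_mem _ lamP) mem_nth // sz; lia.
have dD : 0 < delta <= Delta.
  have /andP[d1 d2] := dist _ (eigA _ eig_lo).
  rewrite (le_trans d1 d2) andbT lt_min !normr_gt0 !subr_eq0.
  by rewrite (lt_eqF lo_lt) (gt_eqF hi_gt).
have [p [sp pE]] := step_approx mu m dD.
have thetaE : theta = delta / Delta by [].
rewrite -thetaE in pE; set B := _ / 2 in pE.
have := @lanczos_approx_dist R n m.+2 A x V (step mu) p B VP isT A_sym sp.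
have pA t : eigenvalue A t -> `|step mu t - p.[t]| <= B.
  by move=> /eigA tb; apply/pE/dist.
have pT t : eigenvalue (lanczos_mx A V) t -> `|step mu t - p.[t]| <= B.
  by move=> /eigT tb; apply/pE/dist.
move=> /(_ pA pT) /le_trans; apply.
have [d0 dD'] := andP dD; have D0 := lt_le_trans d0 dD'.
have th1 : theta <= 1 by rewrite thetaE ler_pdivrMr // mul1r.
have th0 : 0 <= theta by rewrite thetaE divr_ge0 // ltW.
have rho0 : 0 <= (1 - theta) / (1 + theta).
  by rewrite divr_ge0 ?subr_ge0 // addr_ge0.
rewrite /B /Ctheta.
have w_gt0 : 0 < Num.sqrt m.+1%:R :> R by rewrite sqrtr_gt0 ltr0n.
move: (sqr_ge0 (norm2 x)) (exprn_ge0 m.+1 rho0) w_gt0.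
move: (norm2 x ^+ 2) (_ ^+ m.+1) (Num.sqrt m.+1%:R) (_ / Num.sqrt (pi * theta)).
move=> s r w K s0 r0 w0; rewrite -subr_ge0.
have -> : (1 + K) * s / w * r - 2 * (K / w * r / 2) * s = s / w * r.
  by field; rewrite gt_eqF.
by rewrite mulr_ge0 // divr_ge0 // ltW.
Qed.
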